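(* Let $n\ge 1$, $[n]=\{1,\dots,n\}$, let $X_1,\dots,X_n$ be partially ordered sets, $S_i\subset X_i$ subsets, $S=\prod_{j\in[n]}S_j$, and let $u_i:\prod_{j\in[n]}X_j\to\Lambda$, $i\in[n]$, be globally quasi-Leontief functions. For $i\in[n]$ let $\arg\max(u_i;S)$ be the set of points of $S$ at which $u_i$ attains its maximum over $S$, and let $\arg\max(u_i;S)_i$ be the projection of this set on $S_i$. Then $$\prod_{i\in[n]}\arg\max(u_i;S)_i\ \subset\ \mathbf{Nash}(\mathcal{G}),$$ where $\mathcal{G}=(u_i,S_i,X_i)_{i\in[n]}$.
   Context: $\Lambda$ is a totally ordered set. A function $u:X\to\Lambda$ on a partially ordered set is quasi-Leontief if for every $x\in X$ the set $\{x'\in X:u(x')\ge u(x)\}$ equals $\{x'\in X:x'\ge a\}$ for some $a\in X$. A function $u:\prod_{j}X_j\to\Lambda$ is globally quasi-Leontief if it is quasi-Leontief on $\prod_jX_j$ with the product (coordinatewise) order. For a game $\mathcal{G}=(u_i,S_i,X_i)_{i\in[n]}$, $\mathbf{Nash}(\mathcal{G})$ is the (possibly empty) set of Nash points: points $x^\star\in\prod_{j}S_j$ such that for all $i\in[n]$ and all $x_i\in S_i$, $u_i(x^\star)\ge u_i(x^\star_{-i};x_i)$, where $(x^\star_{-i};x_i)$ is $x^\star$ with the $i$-th coordinate replaced by $x_i$. *)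

(* Defs.v *)
From HB Require Import structures.
From mathcomp Require Import all_boot all_order.
From mathcomp Require Import boolp classical_sets.

Set Implicit Arguments.
Unset Strict Implicit.
Unset Printing Implicit Defensive.

Import Order.TTheory.

Local Open Scope order_scope.
Local Open Scope classical_set_scope.

Fact dprod_display : Order.disp_t.
Proof. exact: (Order.Disp tt tt). Qed.

(* An alias for the dependent function space, so that its coordinatewise order
   does not overlap the library's order on non-dependent functions. *)
Definition dprod (I : Type) (d : I -> Order.disp_t)
  (X : forall i, porderType (d i)) : Type := forall i, X i.

Section DProdOrder.
Variables (I : Type) (d : I -> Order.disp_t) (X : forall i, porderType (d i)).
Implicit Types x y z : dprod X.

Definition dprod_le x y : bool := `[< forall i, x i <= y i >].

Fact dprod_le_refl : reflexive dprod_le.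
Proof. by move=> x; apply/asboolP. Qed.

Fact dprod_le_anti : antisymmetric dprod_le.
Proof.
move=> x y /andP[/asboolP xy /asboolP yx]; apply: functional_extensionality_dep.
by move=> i; apply/le_anti; rewrite xy yx.
Qed.

Fact dprod_le_trans : transitive dprod_le.
Proof.
move=> y x z /asboolP xy /asboolP yz; apply/asboolP => i.
exact: le_trans (xy i) (yz i).
Qed.

HB.instance Definition _ := gen_eqMixin (dprod X).
HB.instance Definition _ := gen_choiceMixin (dprod X).
HB.instance Definition _ := Order.Le_isPOrder.Build dprod_display (dprod X)
  dprod_le_refl dprod_le_anti dprod_le_trans.

Lemma dprod_leP x y : reflect (forall i, x i <= y i) (x <= y).
Proof. exact: asboolP. Qed.

Definition dprod_set (S : forall i, set (X i)) : set (dprod X) :=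
  [set x | forall i, S i (x i)].

Definition dprod_proj i (A : set (dprod X)) : set (X i) := [set x i | x in A].

End DProdOrder.

Arguments dprod_proj {I d X} i A.

Definition quasi_Leontief (d : Order.disp_t) (X : porderType d)
    (dL : Order.disp_t) (L : orderType dL) (u : X -> L) : Prop :=
  forall x : X, exists a : X, [set x' | u x' >= u x] = [set x' | x' >= a].

Definition globally_quasi_Leontief (I : Type) (d : I -> Order.disp_t)
    (X : forall i, porderType (d i)) (dL : Order.disp_t) (L : orderType dL)
    (u : dprod X -> L) : Prop :=
  quasi_Leontief u.

Definition argmax (T : Type) (dL : Order.disp_t) (L : orderType dL)
    (u : T -> L) (A : set T) : set T :=
  [set x | A x /\ forall y, A y -> u x >= u y].

(* The players 1, ..., n are indexed by 'I_n, i.e. 0, ..., n - 1. *)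
Record game (n : nat) (d : 'I_n -> Order.disp_t)
    (X : forall i, porderType (d i)) (dL : Order.disp_t) (L : orderType dL) :=
  Game {
    payoff : 'I_n -> dprod X -> L;
    strategies : forall i, set (X i)
  }.

Definition Nash (n : nat) (d : 'I_n -> Order.disp_t)
    (X : forall i, porderType (d i)) (dL : Order.disp_t) (L : orderType dL)
    (G : game X L) : set (dprod X) :=
  [set x | dprod_set (strategies G) x /\
     forall (i : 'I_n) (xi : X i), strategies G xi ->
       payoff G i x >= payoff G i (dfwith x xi)].

(* Main.v *)
(* Let z maximise u_i over S with z_i = x_i, and let y be a deviation of player
   i from x. The upper level set of u_i at y is [a, ->) for some a; it contains
   both y and z. Since y agrees with x off i and z agrees with x at i, a <= x,
   that is, u_i(y) <= u_i(x). *)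
Require Import Defs.
From mathcomp Require Import all_boot all_order.
From mathcomp Require Import boolp classical_sets.

Local Open Scope classical_set_scope.

Theorem proposition2p0p1
  (n : nat) (hn : (1 <= n)%N)
  (dL : Order.disp_t) (L : orderType dL)
  (d : 'I_n -> Order.disp_t) (X : forall i : 'I_n, porderType (d i))
  (S : forall i : 'I_n, set (X i))
  (u : 'I_n -> dprod X -> L)
  (hu : forall i : 'I_n, globally_quasi_Leontief (u i)) :
  dprod_set (fun i : 'I_n => dprod_proj i (argmax (u i) (dprod_set S)))
    `<=` Nash (Game u S).
Proof.
move=> x xP.
(* Each coordinate of [x] comes from its own maximiser, so feasibility is checked one coordinate at
   a time. *)
have Sx : dprod_set S x by move=> i; have [z [Sz _] <-] := xP i; exact: Sz.
split=> // i xi /= Sxi.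
have [z [_ zmax] zi] := xP i.
set y : dprod X := dfwith x xi.
have Sy : dprod_set S y.
  by move=> j; rewrite /y; case: dfwithP => // k _; exact: Sx.
(* [ua] puts the level set of [y] above [a]; [au] is the converse, which reduces the Nash inequality
   to [a <= x]. *)
have [a /seteqP[ua au]] := hu i y.
have /dprod_leP ay : (a <= y)%O := ua y (Order.POrderTheory.lexx _).
(* As [y] is feasible, maximality of [z] over all of [S] places [z] in the level set of [y]. *)
have /dprod_leP az : (a <= z)%O := ua z (zmax y Sy).
apply: (au x); apply/dprod_leP => j.
have [<-|ij] := eqVneq i j; first by rewrite -zi.
by have := ay j; rewrite /y dfwith_out.
Qed.
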